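(* Let $G$ be a connected graph of order $n$ and size $m$ with maximum degree $\Delta$ and minimum degree $\delta$. Then $$BSO(G)\leq \frac{2m\,SDD(G)+M_2^{*}(G)F(G)}{2\,SO(G)},$$ with equality if and only if $G$ is a regular graph (when $G$ is non-bipartite) or $G$ is a $(\Delta,\delta)$-semiregular bipartite graph (when $G$ is bipartite).
   Context: Graphs are finite, simple and undirected; order and size are the numbers of vertices and edges. For a connected graph $G$ with edge set $E(G)$, $d_v$ denotes the degree of the vertex $v$ in $G$. The first Banhatti-Sombor index is $BSO(G)=\sum_{uv\in E(G)}\sqrt{\frac{1}{d_u^2}+\frac{1}{d_v^2}}$, the symmetric division deg index is $SDD(G)=\sum_{uv\in E(G)}\frac{d_u^2+d_v^2}{2d_ud_v}$, the modified second Zagreb index is $M_2^{*}(G)=\sum_{uv\in E(G)}\frac{1}{d_ud_v}$, the forgotten topological index is $F(G)=\sum_{uv\in E(G)}\left(d_u^2+d_v^2\right)$, and the Sombor index is $SO(G)=\sum_{uv\in E(G)}\sqrt{d_u^2+d_v^2}$. A graph $G$ is called $(\Delta,\delta)$-semiregular if $\{d_u,d_v\}=\{\Delta,\delta\}$ holds for all edges $uv\in E(G)$ (the case $\Delta=\delta$ is allowed). *)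

(* Defs.v *)
From mathcomp Require Import all_boot all_order all_algebra.

Set Implicit Arguments.
Unset Strict Implicit.
Unset Printing Implicit Defensive.

Import Order.TTheory GRing.Theory Num.Theory.

Local Open Scope ring_scope.

Record sgraph := SGraph {
  vertex :> finType;
  adj : rel vertex;
  adj_sym : symmetric adj;
  adj_irrefl : irreflexive adj
}.

Definition edges (G : sgraph) : {set {set G}} :=
  [set A : {set G} | [exists u, exists v, adj u v && (A == [set u; v])]].

Definition graph_order (G : sgraph) : nat := #|G|.
Definition graph_size (G : sgraph) : nat := #|edges G|.

Definition deg (G : sgraph) (v : G) : nat := #|[set w : G | adj v w]|.

Definition max_degree (G : sgraph) : nat := (\max_(v : G) deg v)%N.

(* The default value #|G| is harmless: deg v < #|G| for every v, since adj is
   irreflexive. *)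
Definition min_degree (G : sgraph) : nat := \big[minn/#|G|]_(v : G) deg v.

(* The graph without vertices is not connected. *)
Definition connected (G : sgraph) : Prop :=
  (0 < #|G|)%N /\ forall u v : G, connect (@adj G) u v.

Definition bipartite (G : sgraph) : Prop :=
  exists side : G -> bool, forall u v : G, adj u v -> side u != side v.

Definition regular (G : sgraph) : Prop :=
  exists d : nat, forall v : G, deg v = d.

(* =i compares the two lists as sets: {d_u, d_v} = {a, b}. *)
Definition semiregular (a b : nat) (G : sgraph) : Prop :=
  forall u v : G, adj u v -> [:: deg u; deg v] =i [:: a; b].

(* Every edge is a two-element set A = [set u; v] with u != v, so that
   \sum_(w in A) f w is f u + f v and \prod_(w in A) f w is f u * f v. *)

Definition BSO (R : rcfType) (G : sgraph) : R :=
  \sum_(A in edges G) Num.sqrt (\sum_(w in A) 1 / (deg w)%:R ^+ 2).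

Definition SDD (R : rcfType) (G : sgraph) : R :=
  \sum_(A in edges G)
    (\sum_(w in A) (deg w)%:R ^+ 2) / (2 * \prod_(w in A) (deg w)%:R).

Definition modified_zagreb2 (R : rcfType) (G : sgraph) : R :=
  \sum_(A in edges G) 1 / \prod_(w in A) (deg w)%:R.

Definition forgotten (R : rcfType) (G : sgraph) : R :=
  \sum_(A in edges G) \sum_(w in A) (deg w)%:R ^+ 2.

Definition SO (R : rcfType) (G : sgraph) : R :=
  \sum_(A in edges G) Num.sqrt (\sum_(w in A) (deg w)%:R ^+ 2).

(* Main.v *)
Require Import Defs.
From mathcomp Require Import all_boot all_order all_algebra.
From mathcomp Require Import ring zify.

Import Order.TTheory GRing.Theory Num.Theory.

Local Open Scope ring_scope.

(** For an edge e = uv put a_e = sqrt (d_u^2 + d_v^2) and q_e = 1 / (d_u d_v).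
    All five indices are sums of monomials in these two quantities:
    BSO is the sum of a_e q_e, 2 SDD the sum of a_e^2 q_e, M_2* the sum of q_e,
    F the sum of a_e^2, and SO the sum of a_e.  Expanding a square over all
    ordered pairs of edges then gives

      2 m SDD + M_2* F - 2 SO BSO = sum over (e, f) of (a_e - a_f)^2 q_f,

    ([gap_identity]), which is nonnegative since q > 0.  Dividing by 2 SO gives
    the bound.  Moreover equality holds exactly when a is constant, that is,
    when d_u^2 + d_v^2 takes the same value on all edges ([const_edge_lenP]).

    It remains to read off the graphs ([extremal_graphs]).  If d_u^2 + d_v^2 is
    constant, the degree of one end of an edge determines that of the other, so
    in a connected graph the degrees alternate between the same two values
    along every walk.  These two values are then the maximum and the minimum
    degree, and every edge carries both.  When they differ, the degree itself
    is a proper 2-colouring; hence a non-bipartite graph must be regular. *)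

Set Implicit Arguments.
Unset Strict Implicit.
Unset Printing Implicit Defensive.

(** * Weighted sums of squared differences *)

Section WeightedSums.
Variables (R : realFieldType) (I : finType) (E : {set I}) (a q : I -> R).

(** Each monomial of the expanded square is a factor depending on [e] times a
    factor depending on [f], so the double sum splits into products of single
    sums; where the factor in [e] is 1, it sums to [#|E|]. *)
Lemma sum_sqr_diff :
  \sum_(e in E) \sum_(f in E) (a e - a f) ^+ 2 * q f =
  #|E|%:R * (\sum_(f in E) a f ^+ 2 * q f)
  + (\sum_(f in E) q f) * (\sum_(e in E) a e ^+ 2)
  - 2 * ((\sum_(e in E) a e) * (\sum_(f in E) a f * q f)).
Proof.
have row e : \sum_(f in E) (a e - a f) ^+ 2 * q f =
    (\sum_(f in E) a f ^+ 2 * q f)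
    + (\sum_(f in E) q f) * a e ^+ 2
    - 2 * (a e * (\sum_(f in E) a f * q f)).
  rewrite mulr_suml !mulr_sumr -big_split -sumrB /=.
  by apply: eq_bigr => f _; ring.
rewrite (eq_bigr _ (fun e _ => row e)) sumrB big_split /= sumr_const -!mulr_sumr.
by rewrite -mulr_suml -[X in X + _ - _]mulr_natl.
Qed.

Hypothesis q_gt0 : forall f, f \in E -> 0 < q f.

Lemma sum_sqr_diff_ge0 :
  0 <= \sum_(e in E) \sum_(f in E) (a e - a f) ^+ 2 * q f.
Proof.
apply: sumr_ge0 => e _; apply: sumr_ge0 => f fE.
by rewrite mulr_ge0 ?sqr_ge0 // ltW ?q_gt0.
Qed.

Lemma sum_sqr_diff_eq0 :
  \sum_(e in E) \sum_(f in E) (a e - a f) ^+ 2 * q f = 0 <->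
  {in E &, forall e f, a e = a f}.
Proof.
have ge0 e f : f \in E -> 0 <= (a e - a f) ^+ 2 * q f.
  by move=> fE; rewrite mulr_ge0 ?sqr_ge0 // ltW ?q_gt0.
split=> [/eqP | a_const].
  rewrite psumr_eq0 => [/allP zero | e _]; last first.
    by apply: sumr_ge0 => f; apply: ge0.
  move=> e f eE fE; have := zero e (mem_index_enum e).
  rewrite eE psumr_eq0 => [/allP zero_e | g]; last exact: ge0.
  have := zero_e f (mem_index_enum f); rewrite fE.
  by rewrite mulf_eq0 (gt_eqF (q_gt0 fE)) orbF sqrf_eq0 subr_eq0 => /eqP.
apply: big1 => e eE; apply: big1 => f fE.
by rewrite (a_const e f) // subrr expr0n mul0r.
Qed.

End WeightedSums.

(** * Degrees along edges and the extremal graphs *)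

Section Degrees.
Variable G : sgraph.
Implicit Types u v w : G.

Lemma deg_gt0 u v : adj u v -> (0 < deg u)%N.
Proof. by move=> uv; apply/card_gt0P; exists v; rewrite inE. Qed.

Lemma deg_le_max u : (deg u <= max_degree G)%N.
Proof. exact: (leq_bigmax u). Qed.

Lemma max_degree_attained : (0 < #|G|)%N -> exists w : G, max_degree G = deg w.
Proof. by move=> G0; have [w] := bigop.eq_bigmax (@deg G) G0; exists w. Qed.

(** [#|G|] is not neutral for [minn] on [nat], so the monoid lemmas on iterated
    operations do not apply to [min_degree]; hence the induction on the
    enumeration of the vertices. *)
Lemma min_le_deg u : (min_degree G <= deg u)%N.
Proof.
rewrite /min_degree.
have: u \in index_enum G by rewrite mem_index_enum.
elim: (index_enum G) => // w s IHs; rewrite inE big_cons.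
by case/predU1P => [<- | /IHs le_s]; rewrite geq_min ?leqnn // le_s orbT.
Qed.

(** The iterated minimum is either its default value [#|G|] or some degree; in
    the first case every degree, being at most [#|G|], equals it as well. *)
Lemma min_degree_attained : (0 < #|G|)%N -> exists w : G, min_degree G = deg w.
Proof.
move=> /card_gt0P[w0 _].
have [min_le|//] : (#|G| <= min_degree G)%N \/ exists w : G, min_degree G = deg w.
  rewrite /min_degree; elim/big_ind: _ => [|x y Hx Hy|w _].
  - by left.
  - by rewrite /minn; case: ifP.
  - by right; exists w.
exists w0; apply/eqP; rewrite eqn_leq min_le_deg.
exact: leq_trans (max_card _) min_le.
Qed.

Lemma edgesP (A : {set G}) :
  reflect (exists u v, adj u v /\ A = [set u; v]) (A \in edges G).
Proof.
rewrite inE; apply: (iffP existsP) => [[u /existsP[v /andP[uv /eqP ->]]]|].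
  by exists u, v.
by case=> u [v [uv ->]]; exists u; apply/existsP; exists v; rewrite uv eqxx.
Qed.

Lemma mem_edges u v : adj u v -> [set u; v] \in edges G.
Proof. by move=> uv; apply/edgesP; exists u, v. Qed.

Lemma adj_neq u v : adj u v -> u != v.
Proof. by move=> uv; apply: contraL uv => /eqP ->; rewrite adj_irrefl. Qed.

Lemma big_edge (T : Type) (idx : T) (op : Monoid.com_law idx) (f : G -> T) u v :
  adj u v -> \big[op/idx]_(w in [set u; v]) f w = op (f u) (f v).
Proof. by move=> uv; rewrite big_setU1 ?big_set1 // inE adj_neq. Qed.

Definition const_edge_sqr : Prop :=
  forall u v x y : G, adj u v -> adj x y ->
    (deg u ^ 2 + deg v ^ 2 = deg x ^ 2 + deg y ^ 2)%N.

Hypothesis Gconn : connected G.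

Lemma connected_ind (P : pred G) u :
  (forall x y, adj x y -> P x -> P y) -> P u -> forall w, P w.
Proof.
move=> closedP Pu w.
have symG : connect_sym (@adj G) by apply: sym_connect_sym; apply: adj_sym.
have closed : closed (@adj G) P by apply: intro_closed => // x y; apply: closedP.
by have := closed_connect closed (Gconn.2 u w); rewrite /in_mem /= Pu => <-.
Qed.

(** If [x] is adjacent to [y] and has the degree of one end of the edge [uv],
    the equality of the two sums of squares leaves for [y] the degree of the
    other end; connectedness spreads this to all vertices. *)
Lemma const_edge_sqr_two_degrees u v :
  const_edge_sqr -> adj u v -> forall w, deg w \in [:: deg u; deg v].
Proof.
move=> csq uv; apply: (@connected_ind _ u); last by rewrite !inE eqxx.
move=> x y xy; rewrite !inE => /orP[] /eqP dx; apply/orP; [right|left];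
  have := csq _ _ _ _ uv xy; rewrite dx.
- by move/addnI/eqP; rewrite eqn_sqr eq_sym.
- by rewrite addnC => /addnI/eqP; rewrite eqn_sqr eq_sym.
Qed.

Lemma semiregular_const_edge_sqr a b : semiregular a b G -> const_edge_sqr.
Proof.
move=> sr.
have sqr u v : adj u v -> (deg u ^ 2 + deg v ^ 2 = a ^ 2 + b ^ 2)%N.
  move=> /sr eq_ab.
  have := eq_ab (deg u); have := eq_ab (deg v); have := eq_ab a; have := eq_ab b.
  rewrite !inE !eqxx ?orbT /=.
  have [-> | ne_ua] := eqVneq (deg u) a.
    by have [-> | ne_va] := eqVneq (deg v) a => /=; lia.
  lia.
by move=> u v x y /sqr -> /sqr ->.
Qed.

(** The maximum and the minimum degree are attained, hence are among the two
    degrees found on any edge [uv]; as they bound these degrees, they are the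
    larger and the smaller of the two. *)
Lemma const_edge_sqr_semiregular :
  const_edge_sqr -> semiregular (max_degree G) (min_degree G) G.
Proof.
move=> csq u v uv d.
have two := const_edge_sqr_two_degrees csq uv.
have [x max_x] := max_degree_attained Gconn.1.
have [y min_y] := min_degree_attained Gconn.1.
have := two x; have := two y; rewrite -max_x -min_y !inE.
have := deg_le_max u; have := deg_le_max v.
have := min_le_deg u; have := min_le_deg v.
lia.
Qed.

(** Sides can be taken in the finite type [{ffun G -> bool}], so the search for
    a bipartition is a boolean test. *)
Lemma bipartite_dec : bipartite G \/ ~ bipartite G.
Proof.
pose proper (s : {ffun G -> bool}) := [forall u, forall v, adj u v ==> (s u != s v)].
have [/existsP[s /forallP ps]|no] := boolP [exists s, proper s].
  by left; exists s => u v; have /forallP/(_ v)/implyP := ps u.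
right=> -[s ps]; case/existsP: no; exists (finfun s).
by apply/forallP=> u; apply/forallP=> v; apply/implyP; rewrite !ffunE; apply: ps.
Qed.

(** If [a] and [b] differed, having degree [a] would be a bipartition.  So every
    edge has two ends of the same degree, and connectedness spreads it. *)
Lemma semiregular_nonbipartite a b :
  semiregular a b G -> ~ bipartite G -> regular G.
Proof.
move=> sr nbip.
have eq_ab : a = b.
  apply/eqP/contraT=> ne_ab; case: nbip; exists (fun w => deg w == a) => u v /sr eq_uv.
  have := eq_uv a; have := eq_uv b; rewrite !inE !eqxx ?orbT /=.
  move=> {eq_uv}; lia.
have [u _] := card_gt0P Gconn.1.
exists (deg u) => w; apply/eqP.
apply: (@connected_ind (fun z => deg z == deg u) u) => //.
move=> x y /sr eq_xy /eqP <-.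
have := eq_xy (deg x); have := eq_xy (deg y); rewrite eq_ab !inE !eqxx ?orbT /=.
lia.
Qed.

(** This is where the non-bipartite case of the characterization rejoins the
    bipartite one: regularity makes the sum of squares constant on edges. *)
Lemma regular_semiregular :
  regular G -> semiregular (max_degree G) (min_degree G) G.
Proof.
move=> [d reg]; apply: const_edge_sqr_semiregular => u v x y _ _.
by rewrite !reg.
Qed.

Lemma extremal_graphs :
  const_edge_sqr <->
  (~ bipartite G /\ regular G)
  \/ (bipartite G /\ semiregular (max_degree G) (min_degree G) G).
Proof.
split=> [/const_edge_sqr_semiregular sr | [[_ /regular_semiregular] | [_]]].
- have [bip|nbip] := bipartite_dec; first by right.
  by left; split=> //; apply: semiregular_nonbipartite sr nbip.
- exact: semiregular_const_edge_sqr.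
- exact: semiregular_const_edge_sqr.
Qed.

End Degrees.

(** * The indices as weighted sums over edges *)

Section Indices.
Variables (R : rcfType) (G : sgraph).

Definition edge_len (A : {set G}) : R :=
  Num.sqrt (\sum_(w in A) (deg w)%:R ^+ 2).
Definition edge_wt (A : {set G}) : R := (\prod_(w in A) (deg w)%:R)^-1.

Lemma edge_wt_gt0 A : A \in edges G -> 0 < edge_wt A.
Proof.
case/edgesP=> u [v [uv ->]]; rewrite /edge_wt invr_gt0 big_edge //=.
have vu : adj v u by rewrite adj_sym.
by rewrite mulr_gt0 // ltr0n; [apply: deg_gt0 uv | apply: deg_gt0 vu].
Qed.

Lemma edge_len_sqr A : edge_len A ^+ 2 = \sum_(w in A) (deg w)%:R ^+ 2.
Proof. by rewrite sqr_sqrtr // sumr_ge0 // => w _; rewrite sqr_ge0. Qed.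

Lemma edge_len_gt0 A : A \in edges G -> 0 < edge_len A.
Proof.
case/edgesP=> u [v [uv ->]]; rewrite sqrtr_gt0 big_edge //=.
by rewrite ltr_wpDr ?sqr_ge0 // exprn_gt0 // ltr0n (deg_gt0 uv).
Qed.

(** For an edge [uv], [1 / d_u^2 + 1 / d_v^2] is
    [(d_u^2 + d_v^2) / (d_u d_v)^2]; the positive weight [edge_wt] is moved under
    the root by writing it as the root of its square. *)
Lemma BSO_weighted : BSO R G = \sum_(A in edges G) edge_len A * edge_wt A.
Proof.
apply: eq_bigr => A AE; have wt0 := edge_wt_gt0 AE.
rewrite -[X in _ * X](ger0_norm (ltW wt0)) -sqrtr_sqr -sqrtrM; last first.
  by apply: sumr_ge0 => w _; rewrite sqr_ge0.
congr Num.sqrt; move: wt0; case/edgesP: AE => u [v [uv ->]].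
rewrite /edge_wt !big_edge //= invr_gt0 => p0.
have := gt_eqF p0; rewrite mulf_eq0 => /norP[u0 v0].
by field; rewrite u0 v0.
Qed.

Lemma SDD_weighted :
  2 * SDD R G = \sum_(A in edges G) edge_len A ^+ 2 * edge_wt A.
Proof.
rewrite mulr_sumr; apply: eq_bigr => A _.
rewrite edge_len_sqr /edge_wt invfM mulrCA [2 * _]mulrA divff ?mul1r //.
by rewrite pnatr_eq0.
Qed.

Lemma zagreb_weighted : modified_zagreb2 R G = \sum_(A in edges G) edge_wt A.
Proof. by apply: eq_bigr => A _; rewrite div1r. Qed.

Lemma forgotten_weighted : forgotten R G = \sum_(A in edges G) edge_len A ^+ 2.
Proof. by apply: eq_bigr => A _; rewrite edge_len_sqr. Qed.

Lemma const_edge_lenP :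
  {in edges G &, forall A B, edge_len A = edge_len B} <-> const_edge_sqr G.
Proof.
have len u v : adj u v -> edge_len [set u; v] = Num.sqrt (deg u ^ 2 + deg v ^ 2)%:R.
  by move=> uv; rewrite /edge_len big_edge //= natrD !natrX.
split=> [cl u v x y uv xy | csq A B].
  have := cl _ _ (mem_edges uv) (mem_edges xy); rewrite !len // => /eqP.
  by rewrite eqr_sqrt ?ler0n // eqr_nat => /eqP.
case/edgesP=> u [v [uv ->]] /edgesP[x [y [xy ->]]].
by rewrite !len // (csq _ _ _ _ uv xy).
Qed.

Lemma gap_identity :
  2 * (graph_size G)%:R * SDD R G + modified_zagreb2 R G * forgotten R G
  - 2 * SO R G * BSO R G =
  \sum_(A in edges G) \sum_(B in edges G)
     (edge_len A - edge_len B) ^+ 2 * edge_wt B.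
Proof.
rewrite sum_sqr_diff -SDD_weighted -zagreb_weighted -forgotten_weighted.
rewrite -BSO_weighted /graph_size -/(SO R G); ring.
Qed.

End Indices.

Unset Implicit Arguments.

Theorem theorem3p15 (R : rcfType) (G : sgraph) (n m Delta delta : nat)
    (Gconn : connected G)
    (Gorder : graph_order G = n) (Gsize : graph_size G = m)
    (Gmax : max_degree G = Delta) (Gmin : min_degree G = delta) :
  BSO R G <= (2 * m%:R * SDD R G + modified_zagreb2 R G * forgotten R G)
             / (2 * SO R G)
  /\ (BSO R G = (2 * m%:R * SDD R G + modified_zagreb2 R G * forgotten R G)
                / (2 * SO R G)
      <-> (~ bipartite G /\ regular G)
          \/ (bipartite G /\ semiregular Delta delta G)).
Proof.
rewrite -Gsize -Gmax -Gmin -(extremal_graphs Gconn) -(const_edge_lenP R).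
have wt_gt0 := @edge_wt_gt0 R G.
rewrite -(sum_sqr_diff_eq0 _ wt_gt0).
have := sum_sqr_diff_ge0 (@edge_len R G) wt_gt0.
rewrite -gap_identity.
set X := 2 * _ * SDD R G + _.
(* Without edges both sides are 0, the quotient being 0 / 0 = 0; otherwise SO is
   positive and the denominator can be cleared. *)
have [E0 | [A AE]] := set_0Vmem (edges G).
  have no_edge F : \sum_(A in edges G) F A = 0 :> R by rewrite E0 big_set0.
  have -> : BSO R G = 0 by apply: no_edge.
  have -> : SO R G = 0 by apply: no_edge.
  have -> : X = 0.
    by rewrite /X [SDD R G]no_edge [forgotten R G]no_edge !mulr0 addr0.
  by rewrite !mulr0 subrr mul0r lexx.
have SO_gt0 : 0 < 2 * SO R G.
  rewrite mulr_gt0 ?ltr0n // /SO (bigD1 A) //=.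
  rewrite ltr_wpDr ?(edge_len_gt0 R AE) //.
  by apply: sumr_ge0 => B _; rewrite sqrtr_ge0.
rewrite ler_pdivlMr // (mulrC (BSO R G)) subr_ge0; split=> //.
split=> [-> | /eqP]; first by rewrite mulrCA divff ?mulr1 ?subrr // gt_eqF.
by rewrite subr_eq0 => /eqP ->; rewrite mulrAC divff ?mul1r // gt_eqF.
Qed.
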